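(* Let $b\in\mathbb{N}$ and let $a\in\mathbb{Z}$ be relatively prime to $b$. Let $a^*\in\{1,\dots,b-1\}$ satisfy $aa^*\equiv 1\pmod b$. (a) Let $b$ be odd. If $3\nmid b$, then $bT(a,b)\equiv 9+18\left(\frac{a}{b}\right)-a-a^*\pmod{24}$. If $3\mid b$, then $bT(a,b)\equiv 9+18\left(\frac{a}{b}\right)-16\varepsilon-a-a^*\pmod{72}$. (b) Let $b\equiv 2\pmod 4$, or let both $b\equiv 0\pmod 4$ and $a\equiv 3\pmod 4$ hold. If $3\nmid b$, then $bT(a,b)\equiv 6-a-a^*\pmod{24}$. If $3\mid b$, then $bT(a,b)\equiv 54-16\varepsilon-a-a^*\pmod{72}$. (c) Let $b\equiv 0\pmod 4$ and $a\equiv 1\pmod 4$. If $3\nmid b$, then $bT(a,b)\equiv 18-a-a^*\pmod{24}$. If $3\mid b$, then $bT(a,b)\equiv 18-16\varepsilon-a-a^*\pmod{72}$.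
   Context: For $a\in\mathbb{Z}$, $b\in\mathbb{N}$ coprime, write the regular continued fraction expansion $a/b=[q_0,q_1,\dots,q_n]$ with $q_0\in\mathbb{Z}$ and $q_1,\dots,q_n\in\mathbb{N}$, where one does not require $q_n\ge 2$ but instead requires $n$ to be odd. Define $T(a,b)=\sum_{k=0}^{n}(-1)^{k-1}q_k$. The symbol $\left(\frac{a}{b}\right)$ denotes the Jacobi symbol. For an integer $a$ with $3\nmid a$, $\varepsilon\in\{1,-1\}$ is defined by $a\equiv\varepsilon\pmod 3$. *)

(* Defs.v *)
From HB Require Import structures.
From mathcomp Require Import all_boot all_order all_algebra.
From mathcomp Require Import zify ring lra.
Set Implicit Arguments. Unset Strict Implicit. Unset Printing Implicit Defensive.
Import Order.TTheory GRing.Theory Num.Theory.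
Local Open Scope ring_scope.

(* The value [q_0, q_1, ..., q_n] of a continued fraction. As 0^-1 = 0 in rat,
   the one-term fraction [q_0] has value q_0. *)
Fixpoint cf_val (q : seq int) : rat :=
  if q is x :: q' then x%:~R + (cf_val q')^-1 else 0.

(* Here n = (size q).-1, so that oddness of n excludes the empty sequence. *)
Definition odd_regular_cf (a : int) (b : nat) (q : seq int) : bool :=
  [&& odd (size q).-1, all (fun x => 0 < x) (behead q)
    & cf_val q == a%:~R / b%:R].

Lemma regular_cf_ex (b : nat) (a : int) (p : bool) : (0 < b)%N ->
  exists q : seq int, [/\ q != [::], all (fun x => 0 < x) (behead q),
    odd (size q) = p, cf_val q = a%:~R / b%:R & b%:Z < a -> 0 < head 0 q].
Proof.
elim/ltn_ind: b a p => b IH a p b0.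
have bz : (b%:R : rat) != 0 by rewrite pnatr_eq0; lia.
have ea := divz_eq a b.
have rge := @modz_ge0 a b ltac:(lia).
have rlt := @ltz_pmod a b ltac:(lia).
set m := (a %/ b)%Z in ea; set r := (a %% b)%Z in ea rge rlt.
have ab : a%:~R / b%:R = m%:~R + r%:~R / b%:R :> rat.
  by rewrite ea intrD intrM mulrDl /= -pmulrn mulfK.
have [r0|r0] := eqVneq r 0.
  rewrite ab r0 mul0r addr0; case: p.
    by exists [:: m]; split => //=; [rewrite invr0 addr0 | nia].
  exists [:: m - 1; 1]; split => //=; last nia.
  by rewrite invr0 addr0 invr1 rmorphB /= subrK.
have [k rk] : exists k : nat, r = k%:Z by exists `|r|%N; lia.
have [q [q0 qp qs qv qh]] := IH k ltac:(lia) b%:Z (~~ p) ltac:(lia).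
exists (m :: q); split => //=; last nia.
- case: q q0 qp qh {qs qv} => //= x q _ -> ->; lia.
- by rewrite qs negbK.
- by rewrite qv ab rk invf_div -!pmulrn.
Qed.

(* Unconditional: for b = 0 the quotient a / b is 0 = [-1, 1] in rat. *)
Lemma odd_regular_cf_ex (a : int) (b : nat) : exists q, odd_regular_cf a b q.
Proof.
case: b => [|b].
  by exists [:: -1; 1]; rewrite /odd_regular_cf /= invr0 mulr0.
have [q [q0 qp qs qv _]] := @regular_cf_ex b.+1 a false isT.
exists q; rewrite /odd_regular_cf qp qv eqxx !andbT.
by case: q q0 qs {qp qv} => //= x q _ /negbFE.
Qed.

Lemma cf_val_ge1 (q : seq int) : q != [::] -> all (fun x => 0 < x) q ->
  1 <= cf_val q ?= iff (q == [:: 1]).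
Proof.
elim: q => //= x q IH _ /andP[x0 qp].
have x1 : 1 <= (x%:~R : rat) by rewrite ler1z; lia.
have [->|qn] := eqVneq q [::].
  rewrite /= invr0 addr0; apply/leifP; rewrite eqseq_cons andbT.
  case: eqVneq => [->//|xn]; rewrite ltr1z; lia.
have [q1 _] := IH qn qp.
have vi : 0 < (cf_val q)^-1 by rewrite invr_gt0; lra.
apply/leifP; rewrite eqseq_cons (negPf qn) andbF; lra.
Qed.

Lemma regular_cf_uniq (q q' : seq int) :
  q != [::] -> q' != [::] -> odd (size q) = odd (size q') ->
  all (fun x => 0 < x) (behead q) -> all (fun x => 0 < x) (behead q') ->
  cf_val q = cf_val q' -> q = q'.
Proof.
have aux (x y : int) (u v : rat) :
    x%:~R + u = y%:~R + v -> 0 <= u <= 1 -> 0 <= v <= 1 ->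
    (u < 1) || (0 < v) -> (0 < u) || (v < 1) -> x = y.
  move=> e hu hv h1 h2.
  have : (x - y)%:~R < (1 : rat) by rewrite rmorphB /=; case/orP: h2; lra.
  have : (y - x)%:~R < (1 : rat) by rewrite rmorphB /=; case/orP: h1; lra.
  rewrite !ltrz1; lia.
have inv01 (t : seq int) : all (fun x => 0 < x) t ->
    0 <= (cf_val t)^-1 <= 1 /\ (t != [::] -> 0 < (cf_val t)^-1).
  move=> tp; have [->|tn] := eqVneq t [::]; first by rewrite /= invr0.
  have [t1 _] := cf_val_ge1 tn tp.
  have t0 : 0 < (cf_val t)^-1 by rewrite invr_gt0; lra.
  by split => //; rewrite ltW //= invf_le1 //; lra.
have lt1 (t : seq int) : all (fun x => 0 < x) t -> ~~ odd (size t) ->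
    (cf_val t)^-1 < 1.
  case: t => [|x t] tp ts; first by rewrite /= invr0.
  have /leifP := cf_val_ge1 (isT : x :: t != [::]) tp.
  case: eqVneq => [e|_ h]; first by rewrite e in ts.
  by rewrite invf_lt1 //; lra.
elim: q q' => // x q IH [//|y q'] _ _ /= /negb_inj os qp qp' e.
have [hq hq0] := inv01 q qp; have [hq' hq0'] := inv01 q' qp'.
have [qn|qn] := eqVneq q [::]; have [qn'|qn'] := eqVneq q' [::].
- subst; congr (_ :: _).
  by move: e; rewrite /= invr0 !addr0 => /intr_inj.
- have xy : x = y.
    apply: (aux _ _ _ _ e) => //; first by rewrite hq0' // orbT.
    by rewrite lt1 ?orbT // -os qn.
  have := hq0' qn'; move: e; rewrite xy qn /= invr0 => /addrI <-.
  by rewrite ltxx.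
- have xy : x = y.
    apply: (aux _ _ _ _ e) => //; last by rewrite hq0.
    by rewrite lt1 // os qn'.
  have := hq0 qn; move: e; rewrite xy qn' /= invr0 => /addrI ->.
  by rewrite ltxx.
- have xy : x = y by apply: (aux _ _ _ _ e); rewrite ?hq0 ?hq0' ?orbT.
  congr (_ :: _) => //; apply: IH => //.
  + by case: (q) qp => //= ? ? /andP[].
  + by case: (q') qp' => //= ? ? /andP[].
  + by move: e; rewrite xy => /addrI/invr_inj.
Qed.

Definition odd_cf (a : int) (b : nat) : seq int := xchoose (odd_regular_cf_ex a b).

Lemma odd_cfP (a : int) (b : nat) (q : seq int) :
  odd_regular_cf a b q <-> q = odd_cf a b.
Proof.
have h := xchooseP (odd_regular_cf_ex a b); split=> [|-> //].
move: h; rewrite -/(odd_cf a b) => /and3P[o1 p1 /eqP v1] /and3P[o2 p2 /eqP v2].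
apply: regular_cf_uniq => //; last by rewrite v1 v2.
- by case: (q) o2.
- by case: odd_cf o1.
- by case: (q) o2 => //= ? ? ->; case: odd_cf o1 => //= ? ? ->.
Qed.

(* The sign (-1)^(k-1) is written (-1)^(k+1) to keep a natural exponent. *)
Definition T (a : int) (b : nat) : int :=
  \sum_(k < size (odd_cf a b)) (-1) ^+ k.+1 * (odd_cf a b)`_k.

(* Legendre symbol; only meaningful for an odd prime p. *)
Definition legendre (a : int) (p : nat) : int :=
  if (p%:Z %| a)%Z then 0
  else if [exists x : 'I_p, (x%:Z ^+ 2 == a %[mod p%:Z])%Z] then 1 else -1.

(* Jacobi symbol (a / b) for odd b > 0; prime_decomp lists the pairs (p, e) with
   p ^ e exactly dividing b. *)
Definition jacobi (a : int) (b : nat) : int :=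
  \prod_(pe <- prime_decomp b) legendre a pe.1 ^+ pe.2.

(* Main.v *)
Require Import Defs.
From mathcomp Require Import all_boot all_order all_algebra cyclic finfield.
From mathcomp Require Import zify ring.
Set Implicit Arguments. Unset Strict Implicit. Unset Printing Implicit Defensive.
Import Order.TTheory GRing.Theory Num.Theory.
Local Open Scope ring_scope.

(** Grouping the partial quotients of a/b = [q_0, ..., q_n] in pairs writes the
    matrix (a c; b d) of its last two convergents as the product
    U^q_0 L^q_1 U^q_2 ... L^q_n with U = (1 1; 0 1) and L = (1 0; 1 1); here
    d = a* because a d - b c = 1 and 0 < d <= b. Left multiplication by U lowers
    T by 1 and by L raises it by 1, so a congruence for T can be checked one
    generator at a time.

    For odd b the congruence is b T = 1 + 2 (a/b) - a - d modulo 8. Clearly U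
    preserves it. So does the substitution
      N : (a c; b d), T -> (-a c; b -d), 6 - T
    by the value of (-1/b), and for odd a, by quadratic reciprocity, so does
      S : (a c; b d), T -> (b -d; a -c), 3 - T.
    As L = N U^-1 S U, the congruence passes through L when a is even and b is
    odd; when b is even, one follows it at the image under S, which exchanges U
    and L.

    Modulo 3, T is a polynomial in a, b, c, d; when 3 divides b, this determines
    b T modulo 9. *)

(** * Quadratic reciprocity for the Jacobi symbol *)

Lemma euler_criterion (F : finFieldType) (x : F) : odd #|F| -> x != 0 ->
  x ^+ #|F|./2 = if [exists y, y ^+ 2 == x] then 1 else -1.
Proof.
move=> oddF x0; have F_gt1 := finNzRing_gt1 F.
set h := #|F|./2; have [cardF h0] : #|F| = h.*2.+1 /\ (0 < h)%N.
  by rewrite /h; move: oddF F_gt1; move: #|F| => n; lia.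
have unityF (y : F) : y != 0 -> y ^+ h.*2 = 1.
  by move=> y0; apply: (mulfI y0); rewrite -exprS -cardF expf_card mulr1.
case: existsP => [[y /eqP xE]|nonsquare].
  rewrite -xE -exprM mul2n unityF //.
  by move: x0; rewrite -xE expf_eq0.
have /eqP := unityF x x0; rewrite -muln2 exprM sqrf_eq1.
case/orP=> /eqP xh //; case: nonsquare.
have [z _ z_prim] :
    exists2 z : F, z \in enum (predC1 0) & (h.*2).-primitive_root z.
  apply/hasP/has_prim_root; rewrite ?enum_uniq ?double_gt0 //.
    by apply/allP => y; rewrite mem_enum unity_rootE => /unityF ->.
  by rewrite -cardE cardC1 cardF.
have [[i _] /= xE] := prim_rootP z_prim (unityF x x0).
move: xh; rewrite xE -exprM => /eqP; rewrite -(prim_order_dvd z_prim) -mul2n.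
rewrite dvdn_pmul2r // => /dvdnP[k ->].
by exists (z ^+ k); rewrite exprM.
Qed.

Lemma Fp_int_eq (p : nat) (a b : int) : prime p ->
  (a%:~R == b%:~R :> 'F_p) = (a == b %[mod p%:Z])%Z.
Proof.
move=> p_pr; rewrite -subr_eq0 -rmorphB -(dvdz_pcharf (pchar_Fp p_pr)).
by rewrite eqz_mod_dvd.
Qed.

Lemma Fp_nat_eq (p m n : nat) : prime p ->
  (m%:R == n%:R :> 'F_p) = (m == n %[mod p])%N.
Proof. by move=> p_pr; rewrite !pmulrn Fp_int_eq // !modz_nat eqz_nat. Qed.

Lemma Fp_nat_neq0 (p n : nat) : prime p -> (0 < n < p)%N -> n%:R != 0 :> 'F_p.
Proof.
by move=> p_pr n_bnd; rewrite -(dvdn_pcharf (pchar_Fp p_pr)) gtnNdvd; lia.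
Qed.

Section GaussLemma.

Variables p a : nat.
Hypotheses (p_pr : prime p) (p_odd : odd p) (co_pa : coprime p a).

(* Sign and absolute value of the absolutely least residue of a * k modulo p. *)
Definition gauss_sgn (k : nat) : bool := (p./2 < a * k %% p)%N.
Definition gauss_abs (k : nat) : nat :=
  (if gauss_sgn k then p - a * k %% p else a * k %% p)%N.

Lemma gauss_abs_range (k : nat) :
  (0 < k <= p./2)%N -> (0 < gauss_abs k <= p./2)%N.
Proof.
move=> k_bnd; have r_lt : (a * k %% p < p)%N by rewrite ltn_mod prime_gt0.
have : (a * k %% p != 0)%N by rewrite -/(dvdn p _) Gauss_dvdr // gtnNdvd; lia.
rewrite /gauss_abs /gauss_sgn; case: (ltnP p./2); lia.
Qed.

Lemma natr_gauss_abs (k : nat) :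
  (gauss_abs k)%:R = (-1) ^+ gauss_sgn k * (a%:R * k%:R) :> 'F_p.
Proof.
have r_lt : (a * k %% p < p)%N by rewrite ltn_mod prime_gt0.
have rE : (a * k %% p)%:R = a%:R * k%:R :> 'F_p.
  by rewrite -natrM; apply/eqP; rewrite Fp_nat_eq // modn_mod.
rewrite /gauss_abs; case: gauss_sgn; last by rewrite mul1r.
by rewrite natrB ?(ltnW r_lt) // rE pchar_Fp_0 // sub0r mulN1r.
Qed.

Lemma gauss_abs_inj : {in [pred k | 0 < k <= p./2]%N &, injective gauss_abs}.
Proof.
move=> k l; rewrite !inE => k_bnd l_bnd /(congr1 (fun n => n%:R ^+ 2 : 'F_p)).
rewrite !natr_gauss_abs !exprMn !sqrr_sign !mul1r.
have a2 : a%:R ^+ 2 != 0 :> 'F_p.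
  by rewrite expf_eq0 /= -(dvdn_pcharf (pchar_Fp p_pr)) -prime_coprime.
move=> /(mulfI a2)/eqP; rewrite eqf_sqr => /orP[].
  by rewrite Fp_nat_eq // !modn_small; [move/eqP | lia | lia].
rewrite -addr_eq0 -natrD; apply: contraTeq => _.
by apply: Fp_nat_neq0 => //; lia.
Qed.

Lemma gauss_abs_perm :
  perm_eq [seq gauss_abs k | k <- index_iota 1 p./2.+1] (index_iota 1 p./2.+1).
Proof.
have uniq_abs : uniq [seq gauss_abs k | k <- index_iota 1 p./2.+1].
  rewrite map_inj_in_uniq ?iota_uniq // => k l.
  by rewrite !mem_index_iota => k_bnd l_bnd; apply: gauss_abs_inj.
have abs_range : {subset [seq gauss_abs k | k <- index_iota 1 p./2.+1]
                  <= index_iota 1 p./2.+1}.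
  move=> l /mapP[k]; rewrite mem_index_iota => k_bnd ->.
  by rewrite mem_index_iota ltnS gauss_abs_range.
apply: uniq_perm; rewrite ?iota_uniq //.
by case: (uniq_min_size uniq_abs abs_range); rewrite ?size_map.
Qed.

Lemma gauss_lemma :
  a%:R ^+ p./2 = (-1) ^+ (\sum_(1 <= k < p./2.+1) gauss_sgn k)%N :> 'F_p.
Proof.
set N := (\sum_(1 <= k < p./2.+1) gauss_sgn k)%N.
pose P := \prod_(1 <= k < p./2.+1) (k%:R : 'F_p).
have P0 : P != 0.
  rewrite /P big_nat_cond prodf_seq_neq0; apply/allP => k.
  rewrite mem_index_iota => k_bnd; apply/implyP => _.
  by apply: Fp_nat_neq0 => //; lia.
have PE : P = (-1) ^+ N * a%:R ^+ p./2 * P.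
  rewrite {1}/P -(perm_big _ gauss_abs_perm) big_map.
  under eq_bigr => k _ do rewrite natr_gauss_abs.
  by rewrite !big_split /= prodrXr prodr_const_nat subn1 mulrA.
apply: (can_inj (signrMK N)); rewrite -expr2 sqrr_sign.
by apply: (mulIf P0); rewrite mul1r -PE.
Qed.

Lemma odd_sum_gauss_sgn : odd a ->
  odd (\sum_(1 <= k < p./2.+1) gauss_sgn k) =
  odd (\sum_(1 <= k < p./2.+1) (a * k %/ p)).
Proof.
move=> a_odd; have sum_abs :
    (\sum_(1 <= k < p./2.+1) gauss_abs k = \sum_(1 <= k < p./2.+1) k)%N.
  by rewrite -[RHS](perm_big _ gauss_abs_perm) big_map.
have : (2 %| \sum_(1 <= k < p./2.+1)
    ((gauss_sgn k + a * k %/ p) + (gauss_abs k + k)))%N.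
  apply: dvdn_sum => k _.
  have r_lt : (a * k %% p < p)%N by rewrite ltn_mod prime_gt0.
  have := congr1 odd (divn_eq (a * k) p).
  rewrite oddD !oddM a_odd p_odd andbT /gauss_abs /gauss_sgn.
  by case: (ltnP p./2); lia.
rewrite !big_split /= sum_abs; lia.
Qed.

End GaussLemma.

Lemma sum_leq_minn (m n : nat) :
  (\sum_(1 <= l < m.+1) (l <= n) = minn m n)%N.
Proof.
elim: m => [|m IH]; first by rewrite big_geq ?min0n.
by rewrite big_nat_recr //= IH; lia.
Qed.

Lemma divn_count_leq (p q k : nat) : odd p -> odd q -> (k <= p./2)%N ->
  (q * k %/ p = \sum_(1 <= l < q./2.+1) (p * l <= q * k))%N.
Proof.
move=> p_odd q_odd k_half; have p0 : (0 < p)%N by lia.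
under eq_bigr => l _ do rewrite mulnC -leq_divRL //.
rewrite sum_leq_minn; apply/esym/minn_idPr; rewrite -ltnS ltn_divLR //.
have : (q * k.*2 <= q * p.-1)%N by rewrite leq_mul2l; lia.
nia.
Qed.

Lemma eisenstein_lattice (p q : nat) : odd p -> odd q -> coprime p q ->
  (\sum_(1 <= k < p./2.+1) (q * k %/ p) + \sum_(1 <= l < q./2.+1) (p * l %/ q)
   = p./2 * q./2)%N.
Proof.
move=> p_odd q_odd co_pq.
under eq_big_nat => k /andP[_ k_half] do
  rewrite (divn_count_leq p_odd q_odd k_half).
under [X in (_ + X)%N]eq_big_nat => l /andP[_ l_half] do
  rewrite (divn_count_leq q_odd p_odd l_half).
rewrite [X in (_ + X)%N]exchange_big -big_split /=.
transitivity (\sum_(1 <= k < p./2.+1) \sum_(1 <= l < q./2.+1) 1)%N; last first.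
  by rewrite !sum_nat_const_nat !subn1 muln1.
apply: eq_bigr => k _; rewrite -big_split; apply: eq_big_nat => l l_bnd /=.
have : (p * l != q * k)%N.
  apply/eqP => pl_qk; have : (q %| p * l)%N by rewrite pl_qk dvdn_mulr.
  by rewrite Gauss_dvdr 1?coprime_sym // gtnNdvd //; lia.
by case: ltngtP.
Qed.

Lemma legendre_Fp (a : int) (p : nat) : prime p -> odd p ->
  (legendre a p)%:~R = a%:~R ^+ p./2 :> 'F_p.
Proof.
move=> p_pr p_odd; have p_gt1 := prime_gt1 p_pr.
rewrite /legendre (dvdz_pcharf (pchar_Fp p_pr)).
case: eqVneq => [->|a0]; first by rewrite expr0n; case: eqP => //; lia.
rewrite -[X in a%:~R ^+ X./2](card_Fp p_pr) euler_criterion ?card_Fp //.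
have -> : [exists x : 'I_p, (x%:Z ^+ 2 == a %[mod p%:Z])%Z] =
    [exists y : 'F_p, y ^+ 2 == a%:~R].
  apply/existsP/existsP => [[x]|[y]].
    rewrite -Fp_int_eq // rmorphXn => xa.
    by exists x%:~R.
  rewrite -(natr_Zp y) pmulrn -rmorphXn Fp_int_eq // => ya.
  by exists (cast_ord (Fp_cast p_pr) y).
by case: ifP; rewrite ?rmorphN.
Qed.

Lemma legendre_norm (a : int) (p : nat) : `|legendre a p| <= 1.
Proof. by rewrite /legendre; do 2?case: ifP. Qed.

Lemma legendre_Fp_uniq (a x : int) (p : nat) : prime p -> odd p -> `|x| <= 1 ->
  x%:~R = a%:~R ^+ p./2 :> 'F_p -> legendre a p = x.
Proof.
move=> p_pr p_odd x_norm /eqP; rewrite -legendre_Fp // Fp_int_eq // eqz_mod_dvd.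
have p_gt1 := prime_gt1 p_pr; have := legendre_norm a p.
move: (legendre a p) => y y_norm; rewrite dvdzE => /dvdn_leq; lia.
Qed.

Lemma legendreM (a a' : int) (p : nat) : prime p -> odd p ->
  legendre (a * a') p = legendre a p * legendre a' p.
Proof.
move=> p_pr p_odd; apply: legendre_Fp_uniq => //.
  by rewrite normrM mulr_ile1 ?legendre_norm.
by rewrite !rmorphM /= exprMn !legendre_Fp.
Qed.

Lemma legendreN1 (p : nat) : prime p -> odd p -> legendre (-1) p = (-1) ^+ p./2.
Proof.
by move=> p_pr p_odd; apply: legendre_Fp_uniq; rewrite ?normr_sign ?rmorphXn.
Qed.

Lemma eq_legendre (a a' : int) (p : nat) :
  (a = a' %[mod p%:Z])%Z -> legendre a p = legendre a' p.
Proof.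
move=> aa'; rewrite /legendre.
have -> : (p%:Z %| a)%Z = (p%:Z %| a')%Z.
  by apply/dvdz_mod0P/dvdz_mod0P; rewrite aa'.
by case: ifP => // _; under eq_existsb => x do rewrite aa'.
Qed.

Lemma legendre_sqr (a : int) (p : nat) : ~~ (p%:Z %| a)%Z ->
  legendre a p ^+ 2 = 1.
Proof. by move=> /negPf p_ndvd_a; rewrite /legendre p_ndvd_a; case: ifP. Qed.

Lemma legendre_eisenstein (p q : nat) :
  prime p -> odd p -> odd q -> coprime p q ->
  legendre q p = (-1) ^+ (\sum_(1 <= k < p./2.+1) (q * k %/ p))%N.
Proof.
move=> p_pr p_odd q_odd co_pq; apply: legendre_Fp_uniq; rewrite ?normr_sign //.
rewrite -pmulrn gauss_lemma // rmorph_sign.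
by rewrite -[LHS]signr_odd -odd_sum_gauss_sgn // signr_odd.
Qed.

Lemma legendre_reciprocity (p q : nat) :
  prime p -> prime q -> odd p -> odd q -> coprime p q ->
  legendre q p * legendre p q = (-1) ^+ (p./2 * q./2).
Proof.
move=> p_pr q_pr p_odd q_odd co_pq.
rewrite (@legendre_eisenstein p q) //.
rewrite (@legendre_eisenstein q p) 1?coprime_sym //.
by rewrite -exprD eisenstein_lattice.
Qed.

Lemma odd_prime_ind (P : nat -> Prop) : P 1%N ->
  (forall p m, prime p -> odd p -> odd m -> P m -> P (p * m)%N) ->
  forall n, odd n -> P n.
Proof.
move=> P1 PM; elim/ltn_ind => n IH n_odd.
have [n_le1|n_gt1] := leqP n 1; first by have -> : n = 1%N by lia.
have [p p_pr /dvdnP[m nE]] := pdivP n_gt1; have p_gt1 := prime_gt1 p_pr.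
move: n_odd; rewrite nE oddM mulnC => /andP[m_odd p_odd].
by apply: PM => //; apply: IH => //; nia.
Qed.

Lemma signr_halfM (R : pzRingType) (m n : nat) : odd m -> odd n ->
  (-1) ^+ (m * n)./2 = (-1) ^+ m./2 * (-1) ^+ n./2 :> R.
Proof.
move=> m_odd n_odd; rewrite -exprD -[LHS]signr_odd -[RHS]signr_odd.
congr (_ ^+ nat_of_bool _).
have [mE nE] : m = (m./2.*2).+1 /\ n = (n./2.*2).+1 by lia.
have -> : ((m * n)./2 = (m./2 * n./2).*2 + (m./2 + n./2))%N.
  by rewrite {1}mE {1}nE; nia.
by rewrite oddD odd_double.
Qed.

Lemma jacobi1r (a : int) : jacobi a 1 = 1.
Proof. by rewrite /jacobi big_nil. Qed.

Lemma jacobi_prime (a : int) (p : nat) : prime p -> jacobi a p = legendre a p.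
Proof.
move=> p_pr; rewrite /jacobi prime_decompE primes_prime //= big_seq1 /=.
by rewrite logn_prime // eqxx.
Qed.

Lemma jacobi_logn (a : int) (b N : nat) : (b < N)%N ->
  jacobi a b = \prod_(0 <= p < N) legendre a p ^+ logn p b.
Proof.
move=> b_lt; rewrite /jacobi prime_decompE big_map /=.
rewrite (perm_big [seq p <- index_iota 0 N | p \in primes b]) /=; last first.
  apply: uniq_perm; rewrite ?primes_uniq ?filter_uniq ?iota_uniq // => p.
  rewrite mem_filter mem_index_iota /=; case: (boolP (p \in primes b)) => //=.
  by rewrite mem_primes => /and3P[_ b0 /(dvdn_leq b0)]; lia.
rewrite big_filter big_mkcond /=; apply: eq_bigr => p _.
by case: ifPn => //; rewrite -logn_gt0 -eqn0Ngt => /eqP ->.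
Qed.

Lemma jacobiMr (a : int) (m n : nat) : (0 < m)%N -> (0 < n)%N ->
  jacobi a (m * n) = jacobi a m * jacobi a n.
Proof.
move=> m0 n0.
rewrite !(@jacobi_logn _ _ (m * n).+1) ?ltnS ?leq_pmulr ?leq_pmull //.
by rewrite -big_split; apply: eq_bigr => p _; rewrite lognM // exprD.
Qed.

Lemma jacobi_pmul (a : int) (p m : nat) : prime p -> odd m ->
  jacobi a (p * m) = legendre a p * jacobi a m.
Proof.
move=> p_pr m_odd.
by rewrite jacobiMr ?(prime_gt0 p_pr) ?odd_gt0 // jacobi_prime.
Qed.

Lemma jacobiM (a a' : int) (b : nat) : odd b ->
  jacobi (a * a') b = jacobi a b * jacobi a' b.
Proof.
move: b; apply: odd_prime_ind => [|p m p_pr p_odd m_odd IH].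
  by rewrite !jacobi1r.
by rewrite !jacobi_pmul // legendreM // IH mulrACA.
Qed.

Lemma eqz_mod_dvdW (d n x y : int) : (d %| n)%Z ->
  (x = y %[mod n])%Z -> (x = y %[mod d])%Z.
Proof.
move=> d_n /eqP; rewrite eqz_mod_dvd => n_xy; apply/eqP.
by rewrite eqz_mod_dvd (dvdz_trans d_n).
Qed.

Lemma eq_jacobi (a a' : int) (b : nat) : (a = a' %[mod b%:Z])%Z ->
  jacobi a b = jacobi a' b.
Proof.
move=> aa'; rewrite /jacobi prime_decompE [LHS]big_map [RHS]big_map.
apply: eq_big_seq => p; rewrite mem_primes => /and3P[_ _ p_b] /=.
by rewrite (eq_legendre (eqz_mod_dvdW _ aa')).
Qed.

Lemma jacobiN1 (b : nat) : odd b -> jacobi (-1) b = (-1) ^+ b./2.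
Proof.
move: b; apply: odd_prime_ind => [|p m p_pr p_odd m_odd IH].
  by rewrite jacobi1r.
by rewrite jacobi_pmul // legendreN1 // IH signr_halfM.
Qed.

Lemma jacobi_sqr (a : int) (b : nat) : odd b -> coprimez a b ->
  jacobi a b ^+ 2 = 1.
Proof.
move: b; apply: odd_prime_ind => [|p m p_pr p_odd m_odd IH].
  by rewrite jacobi1r.
rewrite PoszM coprimezMr => /andP[co_ap co_am].
rewrite jacobi_pmul // exprMn IH // legendre_sqr //.
by move: co_ap; rewrite coprimez_sym coprimezE prime_coprime.
Qed.

Lemma jacobi1l (b : nat) : odd b -> jacobi 1 b = 1.
Proof.
move=> b_odd; rewrite -[RHS](@jacobi_sqr 1 b) ?coprimezE ?coprime1n //.
by rewrite expr2 -jacobiM // mulr1.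
Qed.

Lemma jacobi_sign (a : int) (b : nat) : odd b -> coprimez a b ->
  jacobi a b = 1 \/ jacobi a b = -1.
Proof.
move=> b_odd co_ab; have /eqP := jacobi_sqr b_odd co_ab.
by rewrite sqrf_eq1 => /orP[] /eqP; [left | right].
Qed.

Lemma jacobi_reciprocityM (m n b : nat) : odd m -> odd n -> odd b ->
  jacobi b m * jacobi m b = (-1) ^+ (m./2 * b./2) ->
  jacobi b n * jacobi n b = (-1) ^+ (n./2 * b./2) ->
  jacobi b (m * n) * jacobi (m * n)%N b = (-1) ^+ ((m * n)./2 * b./2).
Proof.
move=> m_odd n_odd b_odd rec_m rec_n.
rewrite jacobiMr ?odd_gt0 // PoszM jacobiM // mulrACA rec_m rec_n.
by rewrite !exprM signr_halfM // exprMn.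
Qed.

Lemma jacobi_reciprocity (a b : nat) : odd a -> odd b -> coprime a b ->
  jacobi b a * jacobi a b = (-1) ^+ (a./2 * b./2).
Proof.
move=> a_odd b_odd; move: a a_odd b b_odd.
apply: odd_prime_ind => [b b_odd _|p m p_pr p_odd m_odd IHm b b_odd].
  by rewrite jacobi1r jacobi1l.
rewrite coprimeMl => /andP[co_pb co_mb].
apply: jacobi_reciprocityM; rewrite ?IHm //.
move: b b_odd co_pb {co_mb}.
apply: odd_prime_ind => [_|q n q_pr q_odd n_odd IHn].
  by rewrite jacobi1r jacobi1l // muln0.
rewrite coprimeMr => /andP[co_pq co_pn]; rewrite mulrC [X in _ ^+ X]mulnC.
apply: jacobi_reciprocityM; rewrite // mulrC [X in _ ^+ X]mulnC ?IHn //.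
by rewrite !jacobi_prime // legendre_reciprocity.
Qed.

(** * Products of U and L *)

(* UL_product a b c d t: the matrix (a c; b d) is a product of factors U and L,
   and t is the number of factors L minus the number of factors U. *)
Inductive UL_product : nat -> nat -> nat -> nat -> int -> Prop :=
| UL_one : UL_product 1 0 0 1 0
| UL_mulU a b c d t : UL_product a b c d t ->
    UL_product (a + b) b (c + d) d (t - 1)
| UL_mulL a b c d t : UL_product a b c d t ->
    UL_product a (a + b) c (c + d) (t + 1).

Lemma UL_det (a b c d : nat) (t : int) : UL_product a b c d t ->
  (a * d = 1 + b * c)%N.
Proof. by elim=> {a b c d t} // a b c d t _ det; lia. Qed.

Lemma UL_detz (a b c d : nat) (t : int) : UL_product a b c d t ->
  a%:Z * d%:Z = 1 + b%:Z * c%:Z.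
Proof. by move/UL_det; lia. Qed.

Lemma UL_det_natr (R : pzSemiRingType) (a b c d : nat) (t : int) :
  UL_product a b c d t -> a%:R * d%:R = 1 + b%:R * c%:R :> R.
Proof. by move/UL_det/(congr1 (fun n => n%:R : R)); rewrite natrD !natrM. Qed.

Lemma UL_mulU_iter (x a b c d : nat) (t : int) : UL_product a b c d t ->
  UL_product (a + x * b) b (c + x * d) d (t - x%:Z).
Proof.
move=> prod; elim: x => [|x IH]; first by rewrite !mul0n !addn0 subr0.
by rewrite !mulSnr !addnA -addn1 PoszD opprD addrA; apply: UL_mulU.
Qed.

Lemma UL_mulL_iter (y a b c d : nat) (t : int) : UL_product a b c d t ->
  UL_product a (b + y * a) c (d + y * c) (t + y%:Z).
Proof.
move=> prod; elim: y => [|y IH]; first by rewrite !mul0n !addn0 addr0.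
by rewrite !mulSn (addnCA b) (addnCA d) -addn1 PoszD addrA; apply: UL_mulL.
Qed.

(** * The congruence modulo 8 *)

Lemma coprimez_det1 (a b c d : int) : a * d = 1 + b * c -> coprimez a b.
Proof. by move=> det; apply/coprimezP; exists (d, - c) => /=; lia. Qed.

Lemma jacobi_reciprocity_mod8 (a b : nat) : odd a -> odd b -> coprime a b ->
  (2 * (a%:Z * jacobi a b + b%:Z * jacobi b a)
   = 3 * (a%:Z * b%:Z + 1) - (a%:Z + b%:Z) %[mod 8])%Z.
Proof.
move=> a_odd b_odd co_ab; have := jacobi_reciprocity a_odd b_odd co_ab.
have [aE bE] : a = (a./2.*2).+1 /\ b = (b./2.*2).+1 by lia.
have -> : a%:Z * b%:Z = 4 * (a./2 * b./2)%N%:Z + 2 * (a./2 + b./2)%N%:Z + 1.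
  by rewrite {1}aE {1}bE; nia.
have := oddM a./2 b./2; rewrite -signr_odd; move: (a./2 * b./2)%N => mn.
by case mn_odd: (odd mn) => halves_odd; rewrite ?expr0 ?expr1;
  case: (@jacobi_sign a b b_odd co_ab) => ->; rewrite ?mulrN1 ?mulr1; lia.
Qed.

Definition jacobi_congr (a : int) (b : nat) (d t : int) : Prop :=
  (b%:Z * t = 1 + 2 * jacobi a b - a - d %[mod 8])%Z.

Lemma jacobi_congr_shift (k a : int) (b : nat) (d t : int) :
  jacobi_congr a b d t -> jacobi_congr (a + k * b%:Z) b d (t - k).
Proof.
rewrite /jacobi_congr (@eq_jacobi (a + k * b%:Z) a) 1?addrC ?modzMDl //.
rewrite mulrBr [b%:Z * k]mulrC; lia.
Qed.

Lemma jacobi_congrN (a : int) (b : nat) (d t : int) : odd b -> coprimez a b ->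
  jacobi_congr a b d t -> jacobi_congr (- a) b (- d) (6 - t).
Proof.
move=> b_odd co_ab; rewrite /jacobi_congr -[- a]mulN1r jacobiM // jacobiN1 //.
rewrite mulN1r mulrBr -signr_odd.
have := odd_double_half b./2; move: (b%:Z * t) => bt.
by case: odd => /=; case: (jacobi_sign b_odd co_ab) => ->; lia.
Qed.

Lemma odd_coprimez8 (n : nat) : odd n -> coprimez 8 n.
Proof. by move=> n_odd; rewrite coprimezE (@coprime_pexpl 3 2) ?coprime2n. Qed.

Lemma odd_sqr_mod8 (n : nat) : odd n -> (8 %| n%:Z ^+ 2 - 1)%Z.
Proof.
move=> n_odd; have nE : n%:Z = 2 * n./2%:Z + 1 by lia.
have /dvdzP[k kE] : (2 %| n./2%:Z * (n./2%:Z + 1))%Z.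
  by rewrite dvdzE abszM /= dvdn2 oddM; lia.
by apply/dvdzP; exists k; rewrite nE; lia.
Qed.

Lemma jacobi_congr_swap (a b : nat) (c d t : int) : odd a -> odd b ->
  a%:Z * d = 1 + b%:Z * c -> jacobi_congr a b d t ->
  jacobi_congr b a (- c) (3 - t).
Proof.
move=> a_odd b_odd det.
have := jacobi_reciprocity_mod8 a_odd b_odd (coprimez_det1 det).
rewrite /jacobi_congr; move: (jacobi a b) (jacobi b a) => j j' recip congr.
move/eqP: recip; move/eqP: congr; rewrite !eqz_mod_dvd => congr recip.
apply/eqP; rewrite eqz_mod_dvd -(@Gauss_dvdzr 8 b) ?odd_coprimez8 //.
have -> : b%:Z * (a%:Z * (3 - t) - (1 + 2 * j' - b%:Z - - c)) =
    (a%:Z ^+ 2 - 1) + (b%:Z ^+ 2 - 1)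
    - a%:Z * (b%:Z * t - (1 + 2 * j - a%:Z - d))
    - (2 * (a%:Z * j + b%:Z * j') - (3 * (a%:Z * b%:Z + 1) - (a%:Z + b%:Z))).
  by lia.
by rewrite rpredB // rpredB ?dvdz_mull // rpredD ?odd_sqr_mod8.
Qed.

(* L = N U^-1 S U, where S and N are the substitutions of jacobi_congr_swap and
   jacobi_congrN; S applies because a + b and b are odd. *)
Lemma jacobi_congr_L (a b : nat) (c d t : int) : ~~ odd a -> odd b ->
  a%:Z * d = 1 + b%:Z * c -> jacobi_congr a b d t ->
  jacobi_congr a (a + b) (c + d) (t + 1).
Proof.
move=> a_even b_odd det congr_ab.
have ab_odd : odd (a + b) by rewrite oddD (negPf a_even).
have co_a_ab : coprimez (- a%:Z) (a + b)%N.
  by apply: (@coprimez_det1 _ _ c (- (c + d))); lia.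
have congr_U : jacobi_congr (a + b)%N b d (t - 1).
  by have := jacobi_congr_shift 1 congr_ab; rewrite mul1r.
have congr_SU : jacobi_congr b (a + b) (- (c + d)) (3 - (t - 1)).
  by apply: jacobi_congr_swap congr_U => //; lia.
have congr_USU : jacobi_congr (- a%:Z) (a + b) (- (c + d)) (5 - t).
  have := jacobi_congr_shift (-1) congr_SU.
  have -> : b%:Z + -1 * (a + b)%N%:Z = - a%:Z by lia.
  by have -> : 3 - (t - 1) - -1 = 5 - t by lia.
have := jacobi_congrN ab_odd co_a_ab congr_USU; rewrite !opprK.
by have -> : 6 - (5 - t) = t + 1 by lia.
Qed.

(* The second congruence is the first one at the image under S. *)
Definition jacobi_congr_both (a b : nat) (c d t : int) : Prop :=
  (odd b -> jacobi_congr a b d t) /\ (odd a -> jacobi_congr b a (- c) (3 - t)).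

Lemma jacobi_congr_both_swap (a b : nat) (c d t : int) :
  jacobi_congr_both a b c d t -> jacobi_congr_both b a (- d) (- c) (3 - t).
Proof. by case=> congr_ab congr_ba; split; rewrite // opprK subKr. Qed.

Lemma jacobi_congr_both_U (a b : nat) (c d t : int) :
  a%:Z * d = 1 + b%:Z * c -> jacobi_congr_both a b c d t ->
  jacobi_congr_both (a + b) b (c + d) d (t - 1).
Proof.
move=> det [congr_ab congr_ba].
have congr_U : odd b -> jacobi_congr (a + b)%N b d (t - 1).
  by move/congr_ab/(jacobi_congr_shift 1); rewrite mul1r.
split=> // ab_odd; case: (boolP (odd b)) => [b_odd | b_even].
  by apply: jacobi_congr_swap (congr_U b_odd) => //; lia.
have a_odd : odd a by move: ab_odd; rewrite oddD (negPf b_even) addbF.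
have det_swap : b%:Z * - c = 1 + a%:Z * - d by lia.
have := jacobi_congr_L b_even a_odd det_swap (congr_ba a_odd).
rewrite addnC; have -> : - d - c = - (c + d) by lia.
by have -> : 3 - t + 1 = 3 - (t - 1) by lia.
Qed.

Lemma jacobi_congr_both_L (a b : nat) (c d t : int) :
  a%:Z * d = 1 + b%:Z * c -> jacobi_congr_both a b c d t ->
  jacobi_congr_both a (a + b) c (c + d) (t + 1).
Proof.
move=> det /jacobi_congr_both_swap/jacobi_congr_both_U congr_US.
have /congr_US/jacobi_congr_both_swap : b%:Z * - c = 1 + a%:Z * - d by lia.
rewrite addnC opprK; have -> : - (- d - c) = c + d by lia.
by have -> : 3 - (3 - t - 1) = t + 1 by lia.
Qed.

Lemma jacobi_congr_even (a b : nat) (c d t : int) : odd a -> ~~ odd b ->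
  a%:Z * d = 1 + b%:Z * c -> jacobi_congr b a (- c) (3 - t) ->
  (b%:Z * t = (if (b %% 4 == 2)%N || (a %% 4 == 3)%N then 6 else 2)
              - a%:Z - d %[mod 8])%Z.
Proof.
move=> a_odd b_even det /eqP; rewrite eqz_mod_dvd => congr_ba.
set K := if _ then _ else _.
have K_dvd : (8 %| 3 * (a%:Z * b%:Z) - 3 * b%:Z + b%:Z ^+ 2 + 2 - a%:Z * K)%Z.
  have [u bE] : (exists u, b = 4 * u + if b %% 4 == 2 then 2 else 0)%N.
    by exists (b %/ 4)%N; case: eqP; lia.
  have [v aE] : (exists v, a = 4 * v + if a %% 4 == 3 then 3 else 1)%N.
    by exists (a %/ 4)%N; case: eqP; lia.
  rewrite /K; case: eqP bE; case: eqP aE => /= _ -> _ ->; lia.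
have j_dvd : (8 %| 2 * b%:Z * (jacobi b a - 1))%Z.
  case: (@jacobi_sign b a a_odd) => [|->|->]; last lia.
    by rewrite coprimez_sym; exact: coprimez_det1 det.
  by rewrite subrr mulr0.
apply/eqP; rewrite eqz_mod_dvd -(@Gauss_dvdzr 8 a) ?odd_coprimez8 //.
have -> : a%:Z * (b%:Z * t - (K - a%:Z - d)) = (a%:Z ^+ 2 - 1)
    + (3 * (a%:Z * b%:Z) - 3 * b%:Z + b%:Z ^+ 2 + 2 - a%:Z * K)
    - 2 * b%:Z * (jacobi b a - 1)
    - b%:Z * (a%:Z * (3 - t) - (1 + 2 * jacobi b a - b%:Z - - c)).
  by lia.
by rewrite rpredB ?dvdz_mull // rpredB // rpredD ?odd_sqr_mod8.
Qed.

Lemma UL_jacobi_congr (a b c d : nat) (t : int) : UL_product a b c d t ->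
  jacobi_congr_both a b c d t.
Proof.
elim=> {a b c d t} [|a b c d t /UL_detz det IH|a b c d t /UL_detz det IH].
- by split; rewrite // /jacobi_congr jacobi1r.
- by rewrite PoszD; apply: jacobi_congr_both_U.
- by rewrite PoszD; apply: jacobi_congr_both_L.
Qed.

Lemma UL_even_mod8 (a b c d : nat) (t : int) : UL_product a b c d t ->
  ~~ odd b ->
  (b%:Z * t = (if (b %% 4 == 2)%N || (a %% 4 == 3)%N then 6 else 2)
              - a%:Z - d%:Z %[mod 8])%Z.
Proof.
move=> prod b_even; have det := UL_detz prod.
have a_odd : odd a.
  have := congr1 odd (UL_det prod).
  by rewrite oddD !oddM (negPf b_even) => /= /andP[].
have [_ /(_ a_odd)] := UL_jacobi_congr prod.
exact: jacobi_congr_even a_odd b_even det.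
Qed.

(** * The congruences modulo 3 and 9 *)

(* Modulo 3 and for a d - b c = 1 this is the exponent (a + d) b + a c (1 - b^2)
   of the multiplier of the eta function, in a form that S visibly negates. *)
Definition mod3_form (R : pzRingType) (a b c d : R) : R :=
  a * c + b * d + a * b * (a * d + b * c).

Lemma mod3_form_swap (R : comPzRingType) (a b c d : R) :
  mod3_form b a (- d) (- c) = - mod3_form a b c d.
Proof. by rewrite /mod3_form; ring. Qed.

Lemma F3_three_eq0 : 3 = 0 :> 'F_3.
Proof. exact: pchar_Fp_0. Qed.

Lemma F3_cube (x : 'F_3) : x * x * x = x.
Proof. by have := expf_card x; rewrite card_Fp // !exprS mulr1 mulrA. Qed.

Lemma mod3_form_U (a b c d : 'F_3) : a * d = 1 + b * c ->
  mod3_form (a + b) b (c + d) d = mod3_form a b c d + 1.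
Proof.
move=> det; rewrite /mod3_form.
transitivity (a * c + b * d + a * b * (a * d + b * c) + 1
    + 3 * (2 * b * c + b * d + b * b)); first by ring: det (F3_cube b).
by rewrite F3_three_eq0 mul0r addr0.
Qed.

Lemma mod3_form_L (a b c d : 'F_3) : a * d = 1 + b * c ->
  mod3_form a (a + b) c (c + d) = mod3_form a b c d - 1.
Proof.
move=> det; have det_swap : b * - c = 1 + a * - d by ring: det.
apply: oppr_inj; rewrite opprB -!mod3_form_swap [a + b]addrC [c + d]addrC opprD.
by rewrite mod3_form_U // addrC.
Qed.

Lemma UL_mod3 (a b c d : nat) (t : int) : UL_product a b c d t ->
  t%:~R = - mod3_form a%:R b%:R c%:R d%:R :> 'F_3.
Proof.
elim=> {a b c d t} [|a b c d t prod IH|a b c d t prod IH].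
- by rewrite /mod3_form; ring.
- rewrite rmorphB /= IH !natrD mod3_form_U; last exact: UL_det_natr prod.
  by rewrite [RHS]opprD.
- rewrite rmorphD /= IH !natrD mod3_form_L; last exact: UL_det_natr prod.
  by rewrite [RHS]opprB addrC.
Qed.

Lemma UL_ndvd3_mod3 (a b c d : nat) (t : int) : UL_product a b c d t ->
  ~~ (3 %| b)%N -> (b%:Z * t = - a%:Z - d%:Z %[mod 3])%Z.
Proof.
move=> prod; rewrite (dvdn_pcharf (pchar_Fp (isT : prime 3))) => b0.
have b_sqr : b%:R * b%:R = 1 :> 'F_3.
  by apply: (mulIf b0); rewrite F3_cube mul1r.
have det := UL_det_natr 'F_3 prod.
apply/eqP; rewrite -(@Fp_int_eq 3) // rmorphM rmorphB rmorphN /= (UL_mod3 prod).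
rewrite -!pmulrn /mod3_form; apply/eqP.
transitivity (- a%:R - d%:R - 3 * (a%:R * b%:R * c%:R) : 'F_3).
  by ring: det b_sqr.
by rewrite F3_three_eq0 mul0r subr0.
Qed.

Lemma UL_dvd3_mod9 (a b c d : nat) (t eps : int) : UL_product a b c d t ->
  (3 %| b)%N -> eps = 1 \/ eps = -1 -> (a%:Z = eps %[mod 3])%Z ->
  (b%:Z * t = 2 * eps - a%:Z - d%:Z %[mod 9])%Z.
Proof.
move=> prod b_dvd eps1 a_eps; have det := UL_detz prod.
have /dvdzP[n tE] : (3 %| t + a%:Z * c%:Z)%Z.
  rewrite (dvdz_pcharf (pchar_Fp (isT : prime 3))) rmorphD rmorphM /=.
  have b0 : b%:R = 0 :> 'F_3 by apply/eqP; rewrite -(dvdn_pcharf (pchar_Fp _)).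
  by rewrite (UL_mod3 prod) /mod3_form b0 -!pmulrn; apply/eqP; ring.
have [m bE] := dvdnP b_dvd.
have [k aE] : exists k, a%:Z = eps + 3 * k by exists ((a%:Z - eps) %/ 3)%Z; lia.
have [l dE] : exists l, d%:Z = eps + 3 * l.
  exists (eps * (m%:Z * c%:Z - k * d%:Z)).
  by move: det; rewrite aE bE; case: eps1 => ->; lia.
have -> : b%:Z * t = 9 * (m%:Z * n) - a%:Z * (a%:Z * d%:Z - 1).
  have -> : t = n * 3 - a%:Z * c%:Z by lia.
  by rewrite det bE; lia.
apply/eqP; rewrite eqz_mod_dvd; apply/dvdzP.
exists (m%:Z * n - eps * k ^+ 2 - 2 * l * eps * k - 3 * l * k ^+ 2).
by rewrite aE dE; case: eps1 => ->; ring.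
Qed.

(** * Continued fractions *)

Definition alt_sum (q : seq int) : int :=
  \sum_(k < size q) (-1) ^+ k.+1 * q`_k.

Lemma alt_sum_cons (x : int) (q : seq int) : alt_sum (x :: q) = - alt_sum q - x.
Proof.
rewrite /alt_sum big_ord_recl expr1 mulN1r addrC -sumrN; congr (_ - x).
by apply: eq_bigr => k _; rewrite exprS mulN1r mulNr.
Qed.

Lemma intr_addl_div (F : numFieldType) (x m n : int) : n != 0 ->
  x%:~R + m%:~R / n%:~R = (m + x * n)%:~R / n%:~R :> F.
Proof.
by move=> n0; rewrite rmorphD rmorphM mulrDl mulfK ?intr_eq0 // addrC.
Qed.

(* The empty fraction has the value 0 = 1 / 0 in rat. *)
Lemma cf_val_UL_product (q : seq int) :
  ~~ odd (size q) -> all (fun x => 0 < x) q ->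
  exists a b c d : nat, [/\ UL_product a b c d (alt_sum q),
    cf_val q = a%:~R / b%:~R, (c <= a)%N & (c + d <= a + b)%N].
Proof.
have [n] := ubnP (size q); elim: n q => // n IH [|x [|y q]] //= q_size.
  exists 1%N, 0%N, 0%N, 1%N; split; rewrite ?invr0 ?mulr0 //.
  by rewrite /alt_sum big_ord0; apply: UL_one.
rewrite negbK => q_even /and3P[x0 y0 q_pos].
have [|a [b [c [d [prod val ca cd_ab]]]]] := IH q _ q_even q_pos; first lia.
case: x y x0 y0 => // x [] // y x0 y0.
have a0 : (0 < a)%N by have := UL_det prod; lia.
have db : (d + y * c <= b + y * a)%N by nia.
have ca' : (c + x * (d + y * c) <= a + x * (b + y * a))%N.
  by rewrite leq_add // leq_mul.
exists (a + x * (b + y * a))%N, (b + y * a)%N.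
exists (c + x * (d + y * c))%N, (d + y * c)%N; split=> //.
- by rewrite !alt_sum_cons opprD !opprK; apply/UL_mulU_iter/UL_mulL_iter.
- by rewrite val invf_div intr_addl_div // ?invf_div ?intr_addl_div //; lia.
- exact: leq_add.
Qed.

Lemma coprime_frac_inj (m n : int) (a b : nat) : (0 < a)%N -> (0 < b)%N ->
  coprimez m a -> coprimez n b -> m%:~R / a%:~R = n%:~R / b%:~R :> rat ->
  m = n /\ a = b.
Proof.
move=> a0 b0 co_ma co_nb frac_eq.
have := congr1 numq frac_eq; have := congr1 denq frac_eq.
rewrite !coprimeq_num // !coprimeq_den // !gtr0_sg // !mul1r.
by case: eqP; case: eqP; lia.
Qed.

Lemma T_UL_product (a : int) (b : nat) : (0 < b)%N -> coprimez a b ->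
  exists (a' c d : nat) (x t : int), [/\ UL_product a' b c d t,
    a = a'%:Z + x * b%:Z, T a b = t - x & (d <= b)%N].
Proof.
move=> b0 co_ab; have /odd_cfP := erefl (odd_cf a b); rewrite /T -/(alt_sum _).
case: (odd_cf a b) => [|x [|y q]] // /and3P[/= q_even /andP[y0 q_pos]].
have [a' [b' [c [d [prod val ca cd_ab]]]]] := cf_val_UL_product q_even q_pos.
case: y y0 => // y y0; have a0 : (0 < a')%N by have := UL_det prod; lia.
have {}prod := UL_mulL_iter y prod; have B0 : (0 < b' + y * a')%N by nia.
rewrite val invf_div intr_addl_div ?invf_div ?intr_addl_div; [|lia|lia].
rewrite pmulrn; case/eqP/coprime_frac_inj=> // [|aE bE].
  have det := UL_detz prod.
  by apply: (@coprimez_det1 _ _ (c%:Z + x * (d + y * c)%N) (d + y * c)%N); nia.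
exists a', c, (d + y * c)%N, x, (alt_sum q + y); rewrite -aE -bE; split=> //.
  by rewrite !alt_sum_cons opprD !opprK.
by nia.
Qed.

Section InverseCongruences.

Variables (b : nat) (a : int) (astar : nat).
Hypotheses (b0 : (0 < b)%N) (co_ab : coprimez a b%:Z).
Hypotheses (astar_range : (1 <= astar <= b.-1)%N)
  (a_astar : (a * astar%:Z = 1 %[mod b%:Z])%Z).

Lemma T_UL_inverse : exists (a' c : nat) (t : int),
  [/\ UL_product a' b c astar t, (a = a' %[mod b])%Z
    & forall n k : int, (b%:Z * t = k - a'%:Z - astar%:Z %[mod n])%Z ->
        (b%:Z * T a b = k - a - astar%:Z %[mod n])%Z].
Proof.
have [a' [c [d [x [t [prod aE TE db]]]]]] := T_UL_product b0 co_ab.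
have det := UL_detz prod.
have aa' : (a = a' %[mod b])%Z by rewrite aE addrC modzMDl.
have dE : d = astar.
  have : (b%:Z %| a * (d%:Z - astar%:Z))%Z.
    rewrite mulrBr -eqz_mod_dvd a_astar -modzMml aa' modzMml det addrC mulrC.
    by rewrite modzMDl.
  have d0 : (0 < d)%N by have := UL_det prod; case: (d) => //; rewrite muln0.
  rewrite Gauss_dvdzr 1?coprimez_sym // dvdzE => /dvdn_leq; lia.
exists a', c, t; rewrite -dE; split=> // n k /eqP; rewrite eqz_mod_dvd => n_dvd.
apply/eqP; rewrite eqz_mod_dvd TE aE.
have -> : b%:Z * (t - x) - (k - (a'%:Z + x * b%:Z) - d%:Z) =
  b%:Z * t - (k - a'%:Z - d%:Z) by ring.
by [].
Qed.

Lemma T_odd_mod8 : odd b ->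
  (b%:Z * T a b = 1 + 2 * jacobi a b - a - astar%:Z %[mod 8])%Z.
Proof.
move=> b_odd; have [a' [c [t [prod aa' transfer]]]] := T_UL_inverse.
have [/(_ b_odd) congr_ab _] := UL_jacobi_congr prod.
by apply: transfer; rewrite (eq_jacobi aa').
Qed.

Lemma T_even_mod8 : ~~ odd b ->
  (b%:Z * T a b = (if (b %% 4 == 2)%N || (a %% 4 == 3)%Z then 6 else 2)
                  - a - astar%:Z %[mod 8])%Z.
Proof.
move=> b_even; have [a' [c [t [prod aa' transfer]]]] := T_UL_inverse.
apply: transfer; rewrite (UL_even_mod8 prod b_even).
case: eqP => //= b_mod4; have b_dvd : (4 %| b)%N by lia.
by rewrite (eqz_mod_dvdW _ aa') // modz_nat.
Qed.

Lemma T_even_mod8_6 :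
  (b = 2 %[mod 4])%N \/ (b = 0 %[mod 4])%N /\ (a = 3 %[mod 4])%Z ->
  (b%:Z * T a b = 6 - a - astar%:Z %[mod 8])%Z.
Proof.
move=> ab_mod4; have b_even : ~~ odd b by case: ab_mod4 => [|[]]; lia.
by rewrite T_even_mod8 // ifT //; case: ab_mod4 => [->|[_ ->]]; rewrite ?orbT.
Qed.

Lemma T_even_mod8_2 : (b = 0 %[mod 4])%N /\ (a = 1 %[mod 4])%Z ->
  (b%:Z * T a b = 2 - a - astar%:Z %[mod 8])%Z.
Proof.
case=> b_mod4 a_mod4; have b_even : ~~ odd b by lia.
by rewrite T_even_mod8 // ifF // b_mod4 a_mod4.
Qed.

Lemma T_ndvd3_mod3 : ~~ (3 %| b)%N ->
  (b%:Z * T a b = - a - astar%:Z %[mod 3])%Z.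
Proof.
move=> b_ndvd; have [a' [c [t [prod _ transfer]]]] := T_UL_inverse.
by rewrite -[- a]sub0r; apply: transfer; rewrite sub0r (UL_ndvd3_mod3 prod).
Qed.

Lemma T_dvd3_mod9 (eps : int) : (3 %| b)%N -> eps = 1 \/ eps = -1 ->
  (a = eps %[mod 3])%Z -> (b%:Z * T a b = 2 * eps - a - astar%:Z %[mod 9])%Z.
Proof.
move=> b_dvd eps1 a_eps; have [a' [c [t [prod aa' transfer]]]] := T_UL_inverse.
apply: transfer; apply: (UL_dvd3_mod9 prod b_dvd eps1).
by rewrite -(eqz_mod_dvdW _ aa').
Qed.

End InverseCongruences.

Theorem theorem2 (b : nat) (a : int) (astar : nat) :
  (0 < b)%N -> coprimez a b%:Z ->
  (1 <= astar <= b.-1)%N -> (a * astar%:Z = 1 %[mod b%:Z])%Z ->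
  [/\ (odd b ->
        (~~ (3 %| b)%N ->
          (b%:Z * T a b = 9 + 18 * jacobi a b - a - astar%:Z %[mod 24])%Z)
        /\ ((3 %| b)%N -> forall eps : int, eps = 1 \/ eps = -1 ->
          (a = eps %[mod 3])%Z ->
          (b%:Z * T a b
             = 9 + 18 * jacobi a b - 16 * eps - a - astar%:Z %[mod 72])%Z)),
      ((b = 2 %[mod 4])%N \/ (b = 0 %[mod 4])%N /\ (a = 3 %[mod 4])%Z ->
        (~~ (3 %| b)%N ->
          (b%:Z * T a b = 6 - a - astar%:Z %[mod 24])%Z)
        /\ ((3 %| b)%N -> forall eps : int, eps = 1 \/ eps = -1 ->
          (a = eps %[mod 3])%Z ->
          (b%:Z * T a b = 54 - 16 * eps - a - astar%:Z %[mod 72])%Z))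
    & ((b = 0 %[mod 4])%N /\ (a = 1 %[mod 4])%Z ->
        (~~ (3 %| b)%N ->
          (b%:Z * T a b = 18 - a - astar%:Z %[mod 24])%Z)
        /\ ((3 %| b)%N -> forall eps : int, eps = 1 \/ eps = -1 ->
          (a = eps %[mod 3])%Z ->
          (b%:Z * T a b = 18 - 16 * eps - a - astar%:Z %[mod 72])%Z))].
Proof.
move=> b0 co_ab astar_range a_astar.
have odd_mod8 := T_odd_mod8 b0 co_ab astar_range a_astar.
have even_mod8_6 := T_even_mod8_6 b0 co_ab astar_range a_astar.
have even_mod8_2 := T_even_mod8_2 b0 co_ab astar_range a_astar.
have ndvd3_mod3 := T_ndvd3_mod3 b0 co_ab astar_range a_astar.
have dvd3_mod9 := T_dvd3_mod9 b0 co_ab astar_range a_astar.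
by split=> [/odd_mod8 mod8 | /even_mod8_6 mod8 | /even_mod8_2 mod8];
  split=> [/ndvd3_mod3 | /dvd3_mod9 mod9 eps eps1 /(mod9 _ eps1)];
  move: mod8; clear; lia.
Qed.
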